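(* Let $\mathcal{A}$ be a real symmetric tensor of order $m$ and dimension $n$. Then $\mathcal{A}$ is strictly copositive if and only if every principal sub-tensor of $\mathcal{A}$ has no non-positive $Z^{++}$-eigenvalue, i.e., no principal sub-tensor of $\mathcal{A}$ has a ($Z$-)eigenvector $v>0$ with associated $Z$-eigenvalue $\lambda\le 0$.
   Context: Let $m,n$ be positive integers. A real tensor of order $m$ and dimension $n$ is an array $\mathcal{A}=(a_{i_1\cdots i_m})$ with $a_{i_1\cdots i_m}\in\mathbb{R}$, $1\le i_1,\dots,i_m\le n$. It is symmetric if its entries are invariant under every permutation of the indices. For $x\in\mathbb{R}^n$, $\mathcal{A}x^{m-1}\in\mathbb{R}^n$ is the vector with $i$-th component $\sum_{i_2,\dots,i_m=1}^n a_{ii_2\cdots i_m}x_{i_2}\cdots x_{i_m}$, and $\mathcal{A}x^m=x^T(\mathcal{A}x^{m-1})=\sum_{i_1,\dots,i_m=1}^n a_{i_1\cdots i_m}x_{i_1}\cdots x_{i_m}$. For a real vector $x$, $x\ge 0$ (resp. $x>0$) means all components are $\ge 0$ (resp. $>0$); $\mathbb{R}^n_+=\{x\in\mathbb{R}^n: x\ge 0\}$ and $\mathbb{R}^n_{++}=\{x\in\mathbb{R}^n: x>0\}$. $\mathcal{A}$ is strictly copositive if $\mathcal{A}x^m>0$ for all $x\in\mathbb{R}^n_+\setminus\{0\}$. For $1\le r\le n$ and a set $\mathcal{N}\subseteq\{1,\dots,n\}$ with $r$ elements, the array $\mathcal{B}=(a_{i_1\cdots i_m})_{i_1,\dots,i_m\in\mathcal{N}}$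 is an order $m$, dimension $r$ principal sub-tensor of $\mathcal{A}$ (the case $\mathcal{N}=\{1,\dots,n\}$, giving $\mathcal{A}$ itself, is included). For a tensor $\mathcal{B}$ of order $m$ and dimension $r$, a real number $\mu$ is a $Z$-eigenvalue with $Z$-eigenvector $x\in\mathbb{R}^r$ if $\mathcal{B}x^{m-1}=\mu x$ and $x^Tx=1$. It is a $Z^{++}$-eigenvalue of $\mathcal{B}$ if it has a $Z$-eigenvector in $\mathbb{R}^r_{++}$. *)

(* Defs.v *)
From mathcomp Require Import all_boot all_order all_fingroup all_algebra.
From mathcomp Require Import reals.

Set Implicit Arguments.
Unset Strict Implicit.
Unset Printing Implicit Defensive.

Import Order.TTheory GRing.Theory Num.Theory.
Local Open Scope ring_scope.

Definition tensor (R : realType) (m n : nat) := {ffun m.-tuple 'I_n -> R}.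

Definition symmetric_tensor (R : realType) (m n : nat) (A : tensor R m n) :=
  forall (s : 'S_m) (t : m.-tuple 'I_n), A [tuple tnth t (s k) | k < m] = A t.

(* The vector A x^(order - 1). The order is written m.+1 so that it is positive
   and the first index can be singled out. *)
Definition tensor_vec (R : realType) (m n : nat) (A : tensor R m.+1 n)
    (x : 'cV[R]_n) : 'cV[R]_n :=
  \col_i \sum_(t : m.-tuple 'I_n)
            A [tuple of i :: t] * \prod_(k < m) x (tnth t k) 0.

Definition tensor_form (R : realType) (m n : nat) (A : tensor R m n)
    (x : 'cV[R]_n) : R :=
  \sum_(t : m.-tuple 'I_n) A t * \prod_(k < m) x (tnth t k) 0.

Lemma tensor_formE (R : realType) (m n : nat) (A : tensor R m.+1 n)
    (x : 'cV[R]_n) : (x^T *m tensor_vec A x) 0 0 = tensor_form A x.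
Proof.
pose f (p : 'I_n * m.-tuple 'I_n) : m.+1.-tuple 'I_n := [tuple of p.1 :: p.2].
have fbij : bijective f.
  exists (fun t => (thead t, [tuple of behead t])) => [[i t]|t] /=.
    by congr pair; apply: val_inj.
  by rewrite [RHS]tuple_eta.
rewrite mxE /tensor_form (reindex f) /=; last exact: onW_bij.
under eq_bigr do rewrite !mxE big_distrr /=.
rewrite pair_big /=; apply: eq_bigr => -[i t] _ /=.
rewrite big_ord_recl tnth0 mulrCA; congr (_ * (_ * _)).
by apply: eq_bigr => k _; rewrite tnthS.
Qed.

Definition nonneg_vec (R : realType) (n : nat) (x : 'cV[R]_n) :=
  forall i, 0 <= x i 0.

Definition pos_vec (R : realType) (n : nat) (x : 'cV[R]_n) :=
  forall i, 0 < x i 0.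

Definition strictly_copositive (R : realType) (m n : nat) (A : tensor R m n) :=
  forall x : 'cV[R]_n, nonneg_vec x -> x != 0 -> 0 < tensor_form A x.

(* The entries of A with all indices in N; enum_val is the increasing
   enumeration of N. *)
Definition principal_subtensor (R : realType) (m n : nat) (A : tensor R m n)
    (N : {set 'I_n}) : tensor R m #|N| :=
  [ffun t : m.-tuple 'I_#|N| => A [tuple enum_val (tnth t k) | k < m]].

Definition Z_eigenpair (R : realType) (m r : nat) (B : tensor R m.+1 r)
    (mu : R) (x : 'cV[R]_r) :=
  tensor_vec B x = mu *: x /\ x^T *m x = 1%:M.

Definition Zpp_eigenvalue (R : realType) (m r : nat) (B : tensor R m.+1 r)
    (mu : R) :=
  exists x : 'cV[R]_r, Z_eigenpair B mu x /\ pos_vec x.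

(* Main.v *)
(* If x is the extension by zero of a positive Z-eigenvector of a principal
   sub-tensor, then A x^m is its Z-eigenvalue. Conversely, minimise A x^m over the
   unit vectors of the nonnegative orthant. If the minimum mu is nonpositive,
   then on the support N of a minimiser x the positivity constraints are
   inactive, and the first-order conditions say that the restriction of x to N
   is an eigenvector of the sub-tensor on N with eigenvalue mu. *)
Require Import Defs.
From mathcomp Require Import all_boot all_order all_fingroup all_algebra.
From mathcomp Require Import reals.
From mathcomp Require Import boolp classical_sets topology normedtype derive.
(* [finset] comes after [classical_sets] so that [set0] denotes a finite set. *)
From mathcomp Require Import finset ring.

Set Implicit Arguments.
Unset Strict Implicit.
Unset Printing Implicit Defensive.

Import numFieldNormedType.Exports Order.TTheory GRing.Theory Num.Theory.
Local Open Scope ring_scope.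

(** * Homogeneity of the form and splitting off the first index *)

Lemma tensor_formZ (R : realType) (m n : nat) (A : tensor R m n) (a : R)
    (x : 'cV[R]_n) :
  tensor_form A (a *: x) = a ^+ m * tensor_form A x.
Proof.
rewrite /tensor_form big_distrr; apply: eq_bigr => t _ /=.
under eq_bigr do rewrite mxE.
by rewrite big_split prodr_const card_ord /= mulrCA.
Qed.

Lemma sum_tuple_cons (V : nmodType) (m n : nat) (F : m.+1.-tuple 'I_n -> V) :
  \sum_t F t = \sum_i \sum_(t : m.-tuple 'I_n) F [tuple of i :: t].
Proof.
pose f (p : 'I_n * m.-tuple 'I_n) : m.+1.-tuple 'I_n := [tuple of p.1 :: p.2].
have fbij : bijective f.
  exists (fun t => (thead t, [tuple of behead t])) => [[i t]|t] /=.
    by congr pair; apply: val_inj.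
  by rewrite [RHS]tuple_eta.
by rewrite (reindex f) ?pair_big //; apply: onW_bij.
Qed.

(** * Derivative of the form along a line *)

Lemma deriv_prod_seq (R : comNzRingType) (I : eqType) (r : seq I)
    (F : I -> {poly R}) : uniq r ->
  (\prod_(i <- r) F i)^`() =
  \sum_(i <- r) (F i)^`() * \prod_(j <- r | j != i) F j.
Proof.
elim: r => [|a r IH] /=; first by rewrite !big_nil derivC.
case/andP=> ar ur; rewrite !big_cons derivM IH // eqxx /=.
(* Since [a] does not occur in [r], the condition [j != a] drops nothing from the tail, and [a]
   survives in the product for each [i] in [r]. *)
congr (_ * _ + _).
  rewrite big_seq [RHS]big_seq_cond; apply: eq_bigl => j.
  by case jr: (j \in r) => //=; apply/esym/(contraNneq _ ar) => <-.
rewrite big_distrr /= big_seq [RHS]big_seq; apply: eq_bigr => i ir.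
rewrite big_cons ifT; first by rewrite mulrCA.
by apply: contraNneq ar => ->.
Qed.

Lemma deriv_prod (R : comNzRingType) (I : finType) (F : I -> {poly R}) :
  (\prod_i F i)^`() = \sum_i (F i)^`() * \prod_(j | j != i) F j.
Proof. exact/deriv_prod_seq/index_enum_uniq. Qed.

(** Swapping positions [0] and [k] of the index tuple leaves [A] unchanged and brings the factor [d]
    to the first position, where it can be split off. So every slot of the form contributes the same
    amount to a directional derivative. *)
Lemma sum_symmetric_tensor (R : realType) (m n : nat) (A : tensor R m.+1 n)
    (x d : 'cV[R]_n) (k : 'I_m.+1) : symmetric_tensor A ->
  \sum_t A t * (d (tnth t k) 0 * \prod_(j | j != k) x (tnth t j) 0) =
  \sum_i d i 0 * tensor_vec A x i 0.
Proof.
move=> symA; pose s := tperm ord0 k.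
pose h (t : m.+1.-tuple 'I_n) := [tuple tnth t (s j) | j < m.+1].
have hK : involutive h.
  by move=> t; apply: eq_from_tnth => j; rewrite !tnth_mktuple tpermK.
rewrite (reindex_inj (can_inj hK)) /= sum_tuple_cons; apply: eq_bigr => i _.
rewrite mxE big_distrr; apply: eq_bigr => t _ /=.
rewrite symA tnth_mktuple tpermR tnth0 mulrCA; congr (_ * (_ * _)).
rewrite (reindex_inj (@perm_inj _ s)) /=.
under eq_bigl => j do rewrite -[X in _ != X](tpermL ord0 k) (inj_eq perm_inj).
rewrite -/s big_mkcond big_ord_recl /= mul1r; apply: eq_bigr => j _.
by rewrite tnth_mktuple tpermK tnthS.
Qed.

(** A formal polynomial in the line parameter, so that differentiating the form reduces to the
    algebraic product rule. *)
Definition line_poly (R : realType) (m n : nat) (A : tensor R m n)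
    (x d : 'cV[R]_n) : {poly R} :=
  \sum_t (A t)%:P * \prod_k ((x (tnth t k) 0)%:P + (d (tnth t k) 0)%:P * 'X).

Lemma horner_line_poly (R : realType) (m n : nat) (A : tensor R m n)
    (x d : 'cV[R]_n) (t : R) :
  (line_poly A x d).[t] = tensor_form A (x + t *: d).
Proof.
rewrite horner_sum; apply: eq_bigr => u _; rewrite hornerCM horner_prod.
by congr (_ * _); apply: eq_bigr => k _; rewrite !hornerE !mxE [t * _]mulrC.
Qed.

Lemma deriv_line_poly0 (R : realType) (m n : nat) (A : tensor R m.+1 n)
    (x d : 'cV[R]_n) : symmetric_tensor A ->
  (line_poly A x d)^`().[0] = m.+1%:R * \sum_i d i 0 * tensor_vec A x i 0.
Proof.
move=> symA; rewrite /line_poly linear_sum horner_sum /=.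
transitivity (\sum_(k < m.+1) \sum_i d i 0 * tensor_vec A x i 0); last first.
  by rewrite sumr_const card_ord mulr_natl.
under [RHS]eq_bigr => k _ do rewrite -(sum_symmetric_tensor _ _ k) //.
rewrite exchange_big; apply: eq_bigr => t _.
rewrite deriv_mulC hornerCM deriv_prod horner_sum big_distrr.
apply: eq_bigr => k _ /=; congr (_ * _).
rewrite derivD derivC deriv_mulC derivX add0r mulr1 hornerCM horner_prod.
congr (_ * _).
by apply: eq_bigr => j _; rewrite !hornerE.
Qed.

(** * Vectors supported on an index set and principal sub-tensors *)

Lemma sum_tuple_support (R : realType) (m n : nat) (N : {set 'I_n})
    (F : m.-tuple 'I_n -> R) (x : 'cV[R]_n) :
  N != set0 -> (forall i, i \notin N -> x i 0 = 0) ->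
  \sum_(t : m.-tuple 'I_n) F t * \prod_k x (tnth t k) 0 =
  \sum_(t : m.-tuple 'I_#|N|)
     F (map_tuple enum_val t) * \prod_k x (enum_val (tnth t k)) 0.
Proof.
case/set0Pn=> i0 Ni0 x0.
(* A tuple with an index outside [N] has a zero factor. The other tuples are the images under
   [enum_val]; the element [i0] serves as default value for the inverse [enum_rank_in]. *)
rewrite (bigID (fun t : m.-tuple 'I_n => [forall k, tnth t k \in N])) /=.
rewrite [X in _ + X]big1 ?addr0 => [|t /forallPn[k /x0 tk0]]; last first.
  by rewrite (bigD1 k) //= tk0 mul0r mulr0.
rewrite (reindex (map_tuple (@enum_val _ (mem N)))) /=; last first.
  exists (map_tuple (enum_rank_in Ni0)) => t.
    by move=> _; apply: eq_from_tnth => k; rewrite !tnth_map enum_valK_in.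
  rewrite inE => /forallP tN; apply: eq_from_tnth => k.
  by rewrite !tnth_map enum_rankK_in.
rewrite (eq_bigl xpredT) => [|t]; last first.
  by apply/forallP => k; rewrite tnth_map enum_valP.
apply: eq_bigr => t _; congr (_ * _).
by apply: eq_bigr => k _; rewrite tnth_map.
Qed.

Definition restrict_vec (R : realType) (n : nat) (N : {set 'I_n})
  (x : 'cV[R]_n) : 'cV[R]_#|N| := \col_i x (enum_val i) 0.

Lemma tensor_vec_principal (R : realType) (m n : nat) (A : tensor R m.+1 n)
    (N : {set 'I_n}) (x : 'cV[R]_n) (i : 'I_#|N|) :
  N != set0 -> (forall i, i \notin N -> x i 0 = 0) ->
  tensor_vec (principal_subtensor A N) (restrict_vec N x) i 0 =
  tensor_vec A x (enum_val i) 0.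
Proof.
move=> N0 x0; rewrite !mxE (@sum_tuple_support _ _ _ N) //.
apply: eq_bigr => t _; rewrite ffunE; congr (A _ * _); last first.
  by apply: eq_bigr => k _; rewrite mxE.
apply: eq_from_tnth => k; rewrite tnth_mktuple.
by case: (unliftP ord0 k) => [j|] -> ; rewrite ?tnthS ?tnth0 ?tnth_map.
Qed.

Lemma trmulmx_sum (R : realType) (n : nat) (x y : 'cV[R]_n) :
  x^T *m y = (\sum_i x i 0 * y i 0)%:M.
Proof.
rewrite [LHS]mx11_scalar mxE; congr (_%:M).
by apply: eq_bigr => i _; rewrite mxE.
Qed.

Lemma sum_restrict_vec (R : realType) (n : nat) (N : {set 'I_n})
    (x y : 'cV[R]_n) : (forall i, i \notin N -> x i 0 = 0) ->
  \sum_i x i 0 * y i 0 =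
  \sum_i restrict_vec N x i 0 * restrict_vec N y i 0.
Proof.
move=> x0; rewrite (bigID (mem N)) /= [X in _ + X]big1 ?addr0.
  by rewrite big_enum_val; apply: eq_bigr => i _; rewrite !mxE.
by move=> i /x0 ->; rewrite mul0r.
Qed.

Lemma tensor_form_sum (R : realType) (m n : nat) (A : tensor R m.+1 n)
    (x : 'cV[R]_n) :
  tensor_form A x = \sum_i x i 0 * tensor_vec A x i 0.
Proof. by rewrite -tensor_formE trmulmx_sum mxE eqxx. Qed.

Lemma sum_sqr_eq0 (R : realType) (n : nat) (x : 'cV[R]_n) :
  (\sum_i x i 0 ^+ 2 == 0) = (x == 0).
Proof.
rewrite psumr_eq0 => [|i _]; last exact: sqr_ge0.
apply/allP/eqP => [x0|-> i _]; last by rewrite /= mxE expr0n eqxx.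
apply/colP => i; apply/eqP; rewrite mxE -sqrf_eq0.
by apply: x0; rewrite mem_index_enum.
Qed.

(** * Minimising the form on the nonnegative part of the unit sphere *)

Local Open Scope classical_set_scope.

Lemma nonneg_sphere_min (R : realType) (m n : nat) (A : tensor R m n.+1) :
  exists x : 'cV[R]_n.+1, [/\ nonneg_vec x, \sum_i x i 0 ^+ 2 = 1 &
    forall z : 'cV[R]_n.+1, nonneg_vec z -> \sum_i z i 0 ^+ 2 = 1 ->
      tensor_form A x <= tensor_form A z].
Proof.
(* The argument runs on row vectors, the setting of [rV_compact] and [EVT_min_rV]; the minimiser is
   transposed at the end. *)
have coordC (i : 'I_n.+1) : continuous (fun v : 'rV[R]_n.+1 => v 0 i).
  exact: coord_continuous.
pose q (v : 'rV[R]_n.+1) := \sum_i v 0 i ^+ 2.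
have qC : continuous q.
  apply: continuous_big => [|i _ v]; first exact: add_continuous.
  exact: (@continuousM _ _ _ _ _ (coordC i v) (coordC i v)).
have fC : continuous (fun v : 'rV[R]_n.+1 => tensor_form A v^T).
  apply: continuous_big => [|t _ v]; first exact: add_continuous.
  apply: continuousM; first exact: cst_continuous.
  apply: continuous_big => [|k _ w]; first exact: mul_continuous.
  under eq_fun do rewrite mxE.
  exact: coordC.
pose S := [set v : 'rV[R]_n.+1 | (forall i, 0 <= v 0 i) /\ q v = 1].
have Scl : closed S.
  have -> : S = (\bigcap_i [set v : 'rV[R]_n.+1 | 0 <= v 0 i])
      `&` (q @^-1` [set y | y = 1]).
    by apply/seteqP; split => v [v0 qv]; split => // i *; apply: v0.
  apply: closedI.
    apply: closed_bigI => i _.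
    apply: (@preimage_closed _ _ (fun v : 'rV[R]_n.+1 => v 0 i)
      [set y | 0 <= y]) => [v _|]; [exact: coordC | exact: closed_ge].
  by apply: preimage_closed => [v _|]; [exact: qC | exact: closed_eq].
have Scpt : compact S.
  (* [S] lies in the unit cube, as the square of each coordinate is at most [q v = 1]. *)
  have cube := @rV_compact R n.+1 _ (fun=> @segment_compact R 0 1).
  apply: (subclosed_compact Scl cube).
  move=> v [v0 qv] i /=; rewrite in_itv /= v0 /=.
  rewrite -(@ler_pXn2r _ 2) ?nnegrE ?v0 // expr1n -qv /q (bigD1 i) //= lerDl.
  by apply: sumr_ge0 => j _; apply: sqr_ge0.
have S0 : S !=set0.
  exists (delta_mx 0 0); split => [i|]; first by rewrite mxE ler0n.
  rewrite /q (bigD1 0) //= big1 ?mxE ?eqxx ?addr0 ?expr1n // => i i0.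
  by rewrite mxE (negPf i0) expr0n.
have [v] := EVT_min_rV S0 Scpt (continuous_subspaceT fC).
move=> /set_mem[v0 qv] vmin; exists v^T; split=> [i| |z z0 qz].
- by rewrite mxE.
- by rewrite -qv; apply: eq_bigr => i _; rewrite mxE.
- rewrite -[z]trmxK; apply: vmin; apply/mem_set; split=> [i|]; rewrite ?mxE //.
  by rewrite -qz; apply: eq_bigr => i _; rewrite mxE.
Qed.

(** Scaling [z] to norm 1 gives the bound [mu * s ^+ m.+1] with [s] the norm of [z]. As [1 <= s] and
    [mu <= 0], replacing [s] by [s ^+ 2] only lowers it. *)
Lemma tensor_form_ge_sphere_min (R : realType) (m n : nat)
    (A : tensor R m.+1 n) (mu : R) :
  mu <= 0 ->
  (forall z : 'cV[R]_n, nonneg_vec z -> \sum_i z i 0 ^+ 2 = 1 ->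
     mu <= tensor_form A z) ->
  forall z : 'cV[R]_n, nonneg_vec z -> 1 <= \sum_i z i 0 ^+ 2 ->
     mu * (\sum_i z i 0 ^+ 2) ^+ m.+1 <= tensor_form A z.
Proof.
move=> mu0 mumin z z0 q1; set q := \sum_i _ in q1 *.
pose s := Num.sqrt q.
have q0 : 0 < q by apply: lt_le_trans q1.
have s0 : 0 < s by rewrite sqrtr_gt0.
have s2 : s ^+ 2 = q by rewrite sqr_sqrtr // ltW.
have s1 : 1 <= s by rewrite -sqrtr1; apply: ler_wsqrtr.
rewrite -[z](scale1r) -(mulfV (lt0r_neq0 s0)) -scalerA tensor_formZ.
apply: (@le_trans _ _ (s ^+ m.+1 * mu)).
  rewrite mulrC; apply: ler_wnM2r => //; rewrite -s2 -exprM.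
  by rewrite ler_weXn2l // leq_pmull.
rewrite ler_pM2l ?exprn_gt0 //; apply: mumin => [i|].
  by rewrite mxE mulr_ge0 // invr_ge0 ltW.
under eq_bigr do rewrite mxE exprMn.
by rewrite -big_distrr /= -/q -s2 -exprMn mulVf ?expr1n // gt_eqF.
Qed.

(* For a unit vector [x] and [d] orthogonal to [x] and supported where [x] is
   positive, [A(x + t d)^m.+1 - mu (1 + t^2 |d|^2)^m.+1] is a polynomial in [t],
   nonnegative near its zero [t = 0], so its derivative vanishes there. The true
   lower bound has exponent [m.+1 / 2]; as [mu <= 0] the larger exponent, which
   makes it polynomial, is harmless. *)
Lemma sphere_min_eigen (R : realType) (m n : nat) (A : tensor R m.+1 n)
    (x : 'cV[R]_n) :
  symmetric_tensor A -> nonneg_vec x -> \sum_i x i 0 ^+ 2 = 1 ->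
  tensor_form A x <= 0 ->
  (forall z : 'cV[R]_n, nonneg_vec z -> \sum_i z i 0 ^+ 2 = 1 ->
     tensor_form A x <= tensor_form A z) ->
  forall i, 0 < x i 0 -> tensor_vec A x i 0 = tensor_form A x * x i 0.
Proof.
move=> symA x0 qx mu0 xmin; set mu := tensor_form A x in mu0 xmin *.
pose g := tensor_vec A x.
(* The residual of the eigenvalue equation on the support of [x]; the goal is [d = 0]. It is
   orthogonal to [x] because [x] is a unit vector and the products [x i 0 * g i 0] sum to [mu]. *)
pose d : 'cV[R]_n := \col_i (if 0 < x i 0 then g i 0 - mu * x i 0 else 0).
have xd0 : \sum_i x i 0 * d i 0 = 0.
  transitivity (\sum_i (x i 0 * g i 0 - mu * x i 0 ^+ 2)).
    apply: eq_bigr => i _; rewrite mxE; case: ifP => [_|]; first by ring.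
    by rewrite lt_neqAle x0 andbT => /negbFE/eqP <-; ring.
  by rewrite sumrB -big_distrr /= qx -tensor_form_sum mulr1 subrr.
(* A step shorter than [e] keeps all coordinates nonnegative; the summand 1 in the denominator keeps
   it positive when [d i 0] is zero. *)
pose e : R := \big[Num.min/1]_(i | 0 < x i 0) (x i 0 / (1 + `|d i 0|)).
have d1 i : 0 < 1 + `|d i 0| by rewrite ltr_pwDl.
have e0 : 0 < e.
  by apply/bigmin_gtP; split=> [|i xi]; rewrite ?ltr01 ?divr_gt0.
have xtd0 t : `|t| < e -> nonneg_vec (x + t *: d).
  move=> te i; rewrite mxE [(t *: d) i 0]mxE.
  have [xi|xi] := boolP (0 < x i 0); last first.
    by rewrite [d i 0]mxE (negPf xi) mulr0 addr0.
  have tx : `|t| * (1 + `|d i 0|) <= x i 0.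
    rewrite -ler_pdivlMr //; apply: (le_trans (ltW te)).
    exact: bigmin_le_cond.
  rewrite -[t * _]opprK subr_ge0; apply: le_trans tx.
  by rewrite (le_trans (ler_norm _)) // normrN normrM ler_wpM2l // lerDr.
pose D := \sum_i d i 0 ^+ 2.
have qxtd t : \sum_i (x + t *: d) i 0 ^+ 2 = 1 + D * t ^+ 2.
  transitivity (\sum_i (x i 0 ^+ 2 + (t * 2) * (x i 0 * d i 0)
      + t ^+ 2 * d i 0 ^+ 2)).
    by apply: eq_bigr => i _; rewrite !mxE; ring.
  by rewrite !big_split -!big_distrr /= xd0 qx mulr0 addr0 mulrC.
have D0 : 0 <= D by apply: sumr_ge0 => i _; apply: sqr_ge0.
pose p := line_poly A x d - mu%:P * (1 + D%:P * 'X^2) ^+ m.+1.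
have pE t : p.[t] = tensor_form A (x + t *: d) - mu * (1 + D * t ^+ 2) ^+ m.+1.
  by rewrite hornerD hornerN horner_line_poly !hornerE.
have p'0 : p^`().[0] = 0.
  have zoo : 0 \in `]- e, e[%R by rewrite in_itv /= oppr_lt0 e0.
  have pmin : is_derive (0 : R) (1 : R) (horner p) 0.
    apply: (@derive1_at_min _ _ (- e) e) => //.
      by rewrite ge0_cp // ltW.
    move=> t; rewrite in_itv /= -ltr_norml => te.
    rewrite pE scale0r addr0 expr0n mulr0 addr0 expr1n mulr1 subrr pE subr_ge0.
    rewrite -qxtd; apply: tensor_form_ge_sphere_min => //; first exact: xtd0.
    by rewrite qxtd lerDl mulr_ge0 // sqr_ge0.
  by rewrite -(@derive_val _ _ _ _ _ _ _ (is_derive_poly p 0)) derive_val.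
(* The subtracted term of [p] depends on [t] through [t ^+ 2] only, so just the form contributes to
   the derivative at 0. *)
have dg0 : \sum_i d i 0 * g i 0 = 0.
  move: p'0; rewrite derivB hornerD hornerN deriv_line_poly0 // deriv_mulC.
  rewrite deriv_exp derivD derivC deriv_mulC derivXn add0r.
  rewrite hornerCM hornerMn hornerM hornerCM hornerMn hornerX.
  rewrite mul0rn mulr0 mul0r mul0rn mulr0 subr0 => /eqP.
  by rewrite mulf_eq0 pnatr_eq0 /= => /eqP.
(* On the support one factor of [d i 0 ^+ 2] is expanded as [g i 0 - mu * x i 0]; both resulting
   sums vanish. *)
have /eqP : D = 0.
  transitivity (\sum_i (d i 0 * g i 0 - mu * (x i 0 * d i 0))).
    apply: eq_bigr => i _; rewrite mxE; case: ifP => _; ring.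
  by rewrite sumrB -big_distrr /= xd0 dg0 mulr0 subr0.
rewrite sum_sqr_eq0 => /eqP/colP d0 i xi; move: (d0 i).
by rewrite !mxE xi => /eqP; rewrite subr_eq0 => /eqP.
Qed.

Theorem theorem4p3 (R : realType) (m n : nat) (A : tensor R m.+1 n.+1)
    (symA : symmetric_tensor A) :
  strictly_copositive A <->
  (forall N : {set 'I_n.+1}, N != set0 ->
     ~ (exists mu : R, mu <= 0 /\ Zpp_eigenvalue (principal_subtensor A N) mu)).
Proof.
split=> [Acop N N0 [mu [mu0 [y [[By yy] y0]]]] | noeig].
  have [i0 Ni0] := set0Pn _ N0.
  pose x : 'cV[R]_n.+1 :=
    \col_i (if i \in N then y (enum_rank_in Ni0 i) 0 else 0).
  have x_out i : i \notin N -> x i 0 = 0 by move=> /negPf iN; rewrite mxE iN.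
  have xN : restrict_vec N x = y.
    by apply/colP => i; rewrite !mxE enum_valP enum_valK_in.
  have x0 : nonneg_vec x by move=> i; rewrite mxE; case: ifP => // _; apply: ltW.
  have /(Acop x x0) : x != 0.
    apply/eqP => /colP/(_ i0); rewrite !mxE Ni0 => yi.
    by have := y0 (enum_rank_in Ni0 i0); rewrite yi ltxx.
  rewrite tensor_form_sum (sum_restrict_vec _ x_out) xN ltNge => /negP; apply.
  (* The eigenvector equation on [N] makes the sum equal to [mu] times the squared norm of [y], that
     is [mu]. *)
  rewrite (eq_bigr (fun i => mu * (y i 0 * y i 0))) => [|i _]; last first.
    rewrite [restrict_vec _ _ _ _]mxE -tensor_vec_principal // xN By mxE.
    by rewrite mulrCA.
  rewrite -big_distrr /=; move: yy; rewrite trmulmx_sum => /matrixP/(_ 0 0).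
  by rewrite !mxE eqxx !mulr1n => ->; rewrite mulr1.
have [x [x0 qx xmin]] := nonneg_sphere_min A.
(* By homogeneity, a nonzero nonnegative vector may be scaled to unit length, where the form is at
   least its minimum. *)
suff mu_gt0 : 0 < tensor_form A x.
  move=> z z0; rewrite -sum_sqr_eq0 => qz.
  set q := \sum_i _ in qz.
  have q0 : 0 < q.
    by rewrite lt_neqAle eq_sym qz sumr_ge0 // => i _; apply: sqr_ge0.
  have s0 : 0 < (Num.sqrt q)^-1 by rewrite invr_gt0 sqrtr_gt0.
  rewrite -(pmulr_rgt0 _ (exprn_gt0 m.+1 s0)) -tensor_formZ.
  apply: (lt_le_trans mu_gt0); apply: xmin => [i|].
    by rewrite mxE mulr_ge0 // ltW.
  under eq_bigr do rewrite mxE exprMn.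
  by rewrite -big_distrr /= -/q exprVn sqr_sqrtr ?mulVf // ltW.
rewrite ltNge; apply/negP => mu0.
(* The support of the minimiser, nonempty because [x] has norm 1. *)
pose N : {set 'I_n.+1} := [set i | 0 < x i 0]%SET.
have x_out i : i \notin N -> x i 0 = 0.
  by rewrite inE lt_neqAle x0 andbT negbK => /eqP.
have N0 : N != set0.
  apply/negP => /eqP Ne; have : x == 0.
    by apply/eqP/colP => i; rewrite x_out ?mxE // Ne inE.
  by rewrite -sum_sqr_eq0 qx oner_eq0.
apply: (noeig N N0); exists (tensor_form A x); split=> //.
exists (restrict_vec N x); split; last first.
  by move=> i; rewrite mxE; have := enum_valP i; rewrite inE.
split.
  apply/colP => i; rewrite tensor_vec_principal // [RHS]mxE [X in _ * X]mxE.
  by apply: sphere_min_eigen => //; have := enum_valP i; rewrite inE.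
by rewrite trmulmx_sum -sum_restrict_vec // -[in RHS]qx.
Qed.
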